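(* Let $\mathbf{A}\in\mathbb{R}^{n\times n}$ be a symmetric matrix. Fix integers $\ell\ge 1$ and $q\ge 0$, and let $\mathbf{\Omega}\in\mathbb{R}^{n\times\ell}$ be a standard normal random matrix. If $\mathbf{A}$ has $q+1$ or fewer distinct eigenvalues, then $$\mathrm{err}(\xi_{\max}(\mathbf{A};\mathbf{\Omega};q)) = 0\quad\text{with probability one.}$$
   Context: A standard normal matrix $\mathbf{\Omega}\in\mathbb{R}^{n\times\ell}$ has independent real Gaussian entries with mean zero and variance one. ${}^*$ denotes transpose. For a symmetric $\mathbf{A}\in\mathbb{R}^{n\times n}$, a matrix $\mathbf{B}\in\mathbb{R}^{n\times\ell}$ and an integer $q\ge 0$, the block Krylov subspace is $$K_q(\mathbf{A};\mathbf{B}) := \operatorname{range}\begin{bmatrix}\mathbf{B} & \mathbf{A}\mathbf{B} & \mathbf{A}^2\mathbf{B} & \cdots & \mathbf{A}^q\mathbf{B}\end{bmatrix}\subset\mathbb{R}^n$$ (the highest power is $\mathbf{A}^q$). The block Krylov estimate of the maximum eigenvalue is $$\xi_{\max}(\mathbf{A};\mathbf{B};q) := \max_{\mathbf{v}\in K_q(\mathbf{A};\mathbf{B}),\ \mathbf{v}\neq \mathbf{0}} \frac{\mathbf{v}^*\mathbf{A}\mathbf{v}}{\mathbf{v}^*\mathbf{v}}.$$ (This is well defined when $\mathbf{B}\ne\mathbf{0}$, which holds with probability one for $\mathbf{B}=\mathbf{\Omega}$.) Write $a_{\max}$ and $a_{\min}$ for the largest and smallest eigenvalues of $\mathbf{A}$.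 The relative error of an estimate $\xi$ of $a_{\max}$ is $$\mathrm{err}(\xi) := \frac{a_{\max}-\xi}{a_{\max}-a_{\min}},$$ with the convention $0/0=0$. *)

(* Defs.v *)
From HB Require Import structures.
From mathcomp Require Import all_boot all_order all_algebra.
From mathcomp Require Import all_classical all_reals all_analysis.

Set Implicit Arguments.
Unset Strict Implicit.
Unset Printing Implicit Defensive.

Import Order.TTheory GRing.Theory Num.Theory.

Local Open Scope classical_set_scope.
Local Open Scope ring_scope.

(* Attained extrema; the value is 0 when S has no maximum (minimum). *)
Definition max_of (R : realType) (S : set R) : R :=
  xget 0 [set x | S x /\ ubound S x].

Definition min_of (R : realType) (S : set R) : R :=
  xget 0 [set x | S x /\ lbound S x].

Definition eigenvalues (R : realType) (n : nat) (A : 'M[R]_n) : set R :=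
  [set a | eigenvalue A a].

Definition krylov (R : realType) (n l : nat) (A : 'M[R]_n) (B : 'M[R]_(n, l))
    (q : nat) : set 'cV[R]_n :=
  range (mulmx (\mxrow_(k < q.+1) (A ^+ k *m B))).

Definition rayleigh (R : realType) (n : nat) (A : 'M[R]_n) (v : 'cV[R]_n) : R :=
  (v^T *m A *m v) 0 0 / (v^T *m v) 0 0.

Definition xi_max (R : realType) (n l : nat) (A : 'M[R]_n) (B : 'M[R]_(n, l))
    (q : nat) : R :=
  max_of (rayleigh A @` [set v | krylov A B q v /\ v != 0]).

(* The quotient is taken in \bar R, where 0 / 0 = 0 * +oo = 0 whereas x / 0 is
   infinite for x != 0: if A has a single eigenvalue a, then err A xi = 0 still
   forces xi = a, which would not be the case with the inverse of R. *)
Definition err (R : realType) (n : nat) (A : 'M[R]_n) (xi : R) : \bar R :=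
  ((max_of (eigenvalues A) - xi)%:E
   / (max_of (eigenvalues A) - min_of (eigenvalues A))%:E)%E.

Definition mutually_independent (d : measure_display) (T : measurableType d)
    (R : realType) (P : probability T R) (I : finType)
    (X : I -> {RV P >-> R}) : Prop :=
  forall (J : {set I}) (B : I -> set R), (forall i, measurable (B i)) ->
    P (\bigcap_(i in [set` J]) (X i @^-1` B i)) =
    (\prod_(i in J) P (X i @^-1` B i))%E.

Definition standard_normal_mx (d : measure_display) (T : measurableType d)
    (R : realType) (P : probability T R) (n l : nat)
    (Omega : 'M[{RV P >-> R}]_(n, l)) : Prop :=
  (forall i j (B : set R), measurable B ->
     distribution P (Omega i j) B = normal_prob 0 1 B) /\
  mutually_independent (fun ij : 'I_n * 'I_l => Omega ij.1 ij.2).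

Definition realization (d : measure_display) (T : measurableType d)
    (R : realType) (P : probability T R) (n l : nat)
    (Omega : 'M[{RV P >-> R}]_(n, l)) (w : T) : 'M[R]_(n, l) :=
  map_mx (fun X : {RV P >-> R} => X w) Omega.

(* Main.v *)
Require Import Defs.
From HB Require Import structures.
From mathcomp Require Import all_boot all_order all_algebra.
From mathcomp Require Import complex.
From mathcomp Require Import all_classical all_reals all_analysis.
From mathcomp Require Import measurable_realfun.

Set Implicit Arguments.
Unset Strict Implicit.
Unset Printing Implicit Defensive.

Import Order.TTheory GRing.Theory Num.Theory.

Local Open Scope classical_set_scope.
Local Open Scope ring_scope.

(** Let a be the largest eigenvalue of A, with eigenvector u, and let p be the
    product of the factors X - b over the other distinct eigenvalues b; its
    degree is at most q. A symmetric matrix is diagonalizable, so it is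
    annihilated by (X - a) p, so that A p(A) x = a p(A) x for every vector x.
    Taking for x a column of the random matrix, p(A) x lies in the Krylov
    subspace, and its Rayleigh quotient is a as soon as it is nonzero. No
    Rayleigh quotient exceeds a, hence the estimate is exact ([xi_max_exact]).

    Since u p(A) = p(a) u with p(a) != 0, the vector p(A) x can only vanish when
    u x = 0. This is a nontrivial linear relation between independent standard
    normal variables, and it has probability zero
    ([independent_level_set_null]). Independence is only given on product
    events, and the argument stays with these: the space of all variables but
    one is cut into countably many boxes of side delta; within a box, the linear
    relation confines the remaining variable to an interval of length O(delta),
    which has probability O(delta) because the normal density is bounded. The
    product rule on each box and a summation over the boxes bound the whole
    event by O(delta), for every delta > 0.

    The facts on symmetric real matrices are read off from a unitary
    diagonalization of the matrix over the complex numbers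
    ([symmetric_unitary_diag]). *)

(** * Real symmetric matrices *)

Lemma symmetric_unitary_diag (R : rcfType) (n : nat) (A : 'M[R]_n) :
  A^T = A ->
  exists (Q : 'M[complex R]_n) (d : 'rV[R]_n), Q \is unitarymx /\
    map_mx (real_complex R) A =
      invmx Q *m diag_mx (map_mx (real_complex R) d) *m Q.
Proof.
move=> symA; set AC := map_mx _ A.
have hermA : AC \is hermitianmx _ false Num.conj.
  apply: realsym_hermsym.
    by apply/is_hermitianmxP; rewrite expr0 scale1r map_mx_id // map_trmx symA.
  by apply/mxOverP => i j; rewrite mxE; apply/complex_realP; exists (A i j).
exists (spectralmx AC), (\row_j complex.Re (spectral_diag AC 0 j)).
split; first exact: spectral_unitarymx.
have -> : map_mx (real_complex R) (\row_j complex.Re (spectral_diag AC 0 j))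
          = spectral_diag AC.
  apply/rowP => j; rewrite !mxE RRe_real //.
  by move/mxOverP: (hermitian_spectral_diag_real hermA); apply.
exact/orthomx_spectralP/hermitian_normalmx.
Qed.

Lemma eigenvalue_unitary_diag (R : rcfType) (n : nat) (A : 'M[R]_n)
    (Q : 'M[complex R]_n) (d : 'rV[R]_n) (a : R) : Q \in unitmx ->
  map_mx (real_complex R) A =
    invmx Q *m diag_mx (map_mx (real_complex R) d) *m Q ->
  eigenvalue A a = [exists i, d 0 i == a].
Proof.
move=> uQ eA; rewrite -(eigenvalue_map (real_complex R)) eA.
set dC := map_mx _ d; set b := real_complex R a.
apply/eigenvalueP/existsP => [[v]|[i /eqP dia]].
  move=> eqv vN0; pose w := v *m invmx Q.
  have wN0 : w != 0.
    apply: contra_neq vN0 => w0.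
    by rewrite -(mulmxKV uQ v) -/w w0 mul0mx.
  have eqw : w *m diag_mx dC = b *: w.
    by rewrite /w scalemxAl -eqv !mulmxA mulmxK.
  clearbody w; have /rV0Pn[i wi] := wN0.
  exists i; have /rowP/(_ i) := eqw.
  rewrite mul_mx_diag 2![in LHS]mxE [RHS]mxE [RHS]mulrC => /(mulfI wi) h.
  by apply/eqP/(fmorph_inj (real_complex R)).
exists (delta_mx 0 i *m Q).
  rewrite !mulmxA mulmxK // scalemxAl; congr (_ *m Q).
  apply/rowP => j; rewrite mul_mx_diag !mxE eqxx /= mulrC.
  by case: eqVneq => [->|_]; rewrite ?mulr0 // dia.
apply: contraTneq isT => h.
have /rowP/(_ i) : delta_mx 0 i = 0 :> 'rV[complex R]_n.
  by rewrite -(mulmxK uQ (delta_mx 0 i)) h mul0mx.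
by rewrite !mxE !eqxx => /eqP; rewrite oner_eq0.
Qed.

(** Diagonalizability in polynomial form: simple roots at the eigenvalues are
    enough for [p] to annihilate [A]. *)
Lemma symmetric_annihilated (R : rcfType) (n : nat) (A : 'M[R]_n.+1)
    (p : {poly R}) : A^T = A ->
  (forall a, eigenvalue A a -> root p a) -> horner_mx A p = 0.
Proof.
move=> /symmetric_unitary_diag[Q [d [Qu eA]]] pA.
have uQ := unitarymx_unit Qu.
apply: (map_mx_inj (f := real_complex R)).
rewrite map_mx0 map_horner_mx eA.
rewrite horner_mx_uconjC // horner_mx_diag.
suff -> : map_mx (horner (map_poly (real_complex R) p))
            (map_mx (real_complex R) d) = 0.
  by rewrite linear0 mulmx0 mul0mx.
apply/rowP => i; rewrite !mxE horner_map /=.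
have /eqP -> : root p (d 0 i); last by rewrite rmorph0.
apply: pA; rewrite (eigenvalue_unitary_diag _ uQ eA).
by apply/existsP; exists i.
Qed.

Lemma sqnorm_gt0 (R : realDomainType) (n : nat) (v : 'cV[R]_n) :
  v != 0 -> 0 < (v^T *m v) 0 0.
Proof.
move=> /cV0Pn[i vi]; rewrite mxE (bigD1 i) //= ltr_pwDl //.
  by rewrite mxE -expr2 exprn_even_gt0.
by apply: sumr_ge0 => j _; rewrite mxE -expr2 sqr_ge0.
Qed.

(** In the coordinates [w] of [v] in an orthonormal eigenbasis, the Rayleigh
    quotient is the average of the eigenvalues with weights |w_i|^2. *)
Lemma rayleigh_le (R : realType) (n : nat) (A : 'M[R]_n) (a : R) :
  A^T = A -> (forall b, eigenvalue A b -> b <= a) ->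
  forall v : 'cV[R]_n, v != 0 -> rayleigh A v <= a.
Proof.
move=> symA leA v vN0.
have [Q [d [Qu eA]]] := symmetric_unitary_diag symA.
have uQ := unitarymx_unit Qu.
have le_d i : d 0 i <= a.
  apply: leA; rewrite (eigenvalue_unitary_diag _ uQ eA).
  by apply/existsP; exists i.
have vv_gt0 := sqnorm_gt0 vN0.
rewrite /rayleigh ler_pdivrMr // -lecR.
pose vC := map_mx (real_complex R) v; pose w := Q *m vC.
have wE : map_mx Num.conj w^T = vC^T *m invmx Q.
  rewrite /w trmx_mul map_mxM invmx_unitary //; congr (_ *m _).
  apply/matrixP => i j; rewrite !mxE; apply: conj_Creal.
  by apply/complex_realP; exists (v j i).
have -> : real_complex R ((v^T *m A *m v) 0 0) =
    \sum_i real_complex R (d 0 i) * `|w i 0| ^+ 2.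
  transitivity ((vC^T *m map_mx (real_complex R) A *m vC) 0 0).
    by rewrite map_trmx -!map_mxM [RHS]mxE.
  rewrite eA !mulmxA -wE -!mulmxA -/w mxE; apply: eq_bigr => i _.
  by rewrite mul_diag_mx !mxE normCKC mulrCA.
have -> : real_complex R (a * (v^T *m v) 0 0) =
    \sum_i real_complex R a * `|w i 0| ^+ 2.
  transitivity (real_complex R a * (vC^T *m vC) 0 0).
    rewrite rmorphM /=; congr (_ * _).
  by rewrite map_trmx -!map_mxM [RHS]mxE.
  have -> : vC^T *m vC = map_mx Num.conj w^T *m w.
    by rewrite wE /w mulmxA mulmxKV.
  rewrite mxE -mulr_sumr; congr (_ * _); apply: eq_bigr => i _.
  by rewrite !mxE normCKC.
by apply: ler_sum => i _; rewrite ler_wpM2r ?exprn_ge0 // lecR.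
Qed.

(** * Krylov subspaces *)

Lemma max_ofE (R : realType) (S : set R) (x : R) :
  S x -> ubound S x -> max_of S = x.
Proof.
move=> Sx ubSx; rewrite /max_of; apply: xget_unique => // y [Sy ubSy].
by apply/eqP; rewrite eq_le ubSx //= ubSy.
Qed.

Lemma symmetric_max_eigenvalue (R : rcfType) (n : nat) (A : 'M[R]_n.+1) :
  A^T = A -> exists2 a, eigenvalue A a & forall b, eigenvalue A b -> b <= a.
Proof.
move=> /symmetric_unitary_diag[Q [d [Qu eA]]].
have eigA := eigenvalue_unitary_diag _ (unitarymx_unit Qu) eA.
exists (d 0 [arg max_(i > ord0) d 0 i]%O).
  by rewrite eigA; apply/existsP; eexists.
move=> b; rewrite eigA => /existsP[i /eqP <-].
by case: arg_maxP => // j _; apply.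
Qed.

Lemma horner_mx_krylov (R : realType) (n l q : nat) (A : 'M[R]_n.+1)
    (B : 'M[R]_(n.+1, l)) (p : {poly R}) (x : 'cV[R]_l) :
  (size p <= q.+1)%N -> krylov A B q (horner_mx A p *m (B *m x)).
Proof.
move=> sp; exists (\mxcol_(k < q.+1) (p`_k *: x)) => //.
rewrite mul_mxrow_mxcol mulmxA.
have -> : horner_mx A p = \sum_(k < q.+1) p`_k *: A ^+ k.
  rewrite /horner_mx /horner_morph (@horner_coef_wide _ q.+1) ?size_map_poly //.
  apply: eq_bigr => k _.
  by rewrite coef_map /= -[LHS]/(_ *m _) mul_scalar_mx.
rewrite -mulmxA mulmx_suml; apply: eq_bigr => k _.
by rewrite -scalemxAr -scalemxAl mulmxA.
Qed.

Lemma horner_mx_eigenvector (F : fieldType) (n : nat) (A : 'M[F]_n.+1) (a : F)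
    (u : 'rV[F]_n.+1) (p : {poly F}) :
  u *m A = a *: u -> u *m horner_mx A p = p.[a] *: u.
Proof.
move=> eqA; elim/poly_ind: p => [|p c IHp].
  by rewrite rmorph0 mulmx0 horner0 scale0r.
rewrite rmorphD rmorphM /= horner_mx_X horner_mx_C mulmxDr -[_ * _]/(_ *m _).
rewrite mulmxA IHp -scalemxAl eqA mul_mx_scalar.
by rewrite hornerMXaddC scalerDl scalerA.
Qed.

(** Some column of [B] has a component along the top eigenvector [u]. The
    polynomial vanishing at the other eigenvalues kills the rest of this column
    and turns it into a top eigenvector inside the Krylov subspace. *)
Lemma xi_max_exact (R : realType) (n l q : nat) (A : 'M[R]_n.+1)
    (B : 'M[R]_(n.+1, l)) (a : R) (u : 'rV[R]_n.+1) :
  A^T = A -> (eigenvalues A #<= `I_q.+1)%card ->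
  (forall b, eigenvalue A b -> b <= a) ->
  u *m A = a *: u -> u *m B != 0 -> xi_max A B q = a.
Proof.
move=> symA cardA lea eqA uBN0.
have finA : finite_set (eigenvalues A) by apply/finite_set_leP; exists q.+1.
pose s : seq R := finmap.enum_fset (fset_set (eigenvalues A)).
have mems b : (b \in s) = (eigenvalue A b).
  rewrite [LHS]in_fset_set //.
  by apply/idP/idP => [/set_mem|?] //; exact/mem_set.
have us : uniq s := finmap.fset_uniq _.
have sizes : (size s <= q.+1)%N by exact: geq_card_fset_set.
have uN0 : u != 0 by apply: contraNneq uBN0 => ->; rewrite mul0mx.
have eiga : a \in s by rewrite mems; apply/eigenvalueP; exists u.
have [j uBj] : exists j, (u *m B) 0 j != 0 by exact/rV0Pn.
pose p : {poly R} := \prod_(b <- rem a s) ('X - b%:P).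
have sizep : (size p <= q.+1)%N.
  rewrite size_prod_XsubC size_rem // prednK // lt0n size_eq0.
  by case: (s) eiga.
have pN0 : p.[a] != 0.
  rewrite -/(root p a) root_prod_XsubC rem_filter // mem_filter /= eqxx //.
pose v : 'cV[R]_n.+1 := horner_mx A p *m (B *m delta_mx j 0).
have vN0 : v != 0.
  apply: contra_neq uBj => v0.
  have : u *m v = 0 by rewrite v0 mulmx0.
  rewrite /v mulmxA (horner_mx_eigenvector p eqA) -scalemxAl => /eqP.
  rewrite scaler_eq0 (negPf pN0) /= mulmxA -colE => /eqP/matrixP/(_ 0 0).
  by rewrite !mxE.
have eigv : A *m v = a *: v.
  have : horner_mx A (('X - a%:P) * p) = 0.
    apply: symmetric_annihilated => // b; rewrite -mems => bs.
    suff -> : ('X - a%:P) * p = \prod_(c <- s) ('X - c%:P).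
      by rewrite root_prod_XsubC.
    by rewrite (big_rem a eiga).
  rewrite rmorphM rmorphB /= horner_mx_X horner_mx_C.
  move=> ann; apply/eqP; rewrite -subr_eq0 -mul_scalar_mx -mulmxBl /v mulmxA.
  by rewrite [X in X *m _]ann mul0mx.
apply: max_ofE.
  exists v; first by split => //; exact: horner_mx_krylov.
  rewrite /rayleigh -mulmxA eigv -scalemxAr mxE mulfK //.
  by rewrite gt_eqF // sqnorm_gt0.
move=> _ [w [_ wN0] <-]; exact: rayleigh_le.
Qed.

(** * Linear relations between independent variables *)

(** A conditional bound holding in each fibre of a discrete variable integrates
    to an unconditional one. *)
Lemma le_measure_fibres (d : measure_display) (T : measurableType d)
    (R : realType) (P : probability T R) (C : countType) (kappa : T -> C)
    (E : set T) (r : R) :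
  (forall k, measurable (kappa @^-1` [set k])) -> measurable E -> 0 <= r ->
  (forall k, (P (E `&` kappa @^-1` [set k]) <=
              r%:E * P (kappa @^-1` [set k]))%E) ->
  (P E <= r%:E)%E.
Proof.
move=> mk mE r0 le_fibre.
(* The fibres are indexed by codes in nat, where countable additivity is
   stated. *)
pose G (m : nat) : set T := [set w | pickle (kappa w) = m].
have GE m : G m = if unpickle m is Some k then
    (if pickle k == m then kappa @^-1` [set k] else set0) else set0.
  apply/seteqP; split => [w <-|w].
    by rewrite pickleK eqxx.
  by case: (unpickle m) => // k; case: eqP => // <- /= <-.
have mG m : measurable (G m).
  by rewrite GE; case: unpickle => // k; case: ifP.
have leG m : (P (E `&` G m) <= r%:E * P (G m))%E.
  rewrite GE; case: unpickle => [k|]; last by rewrite setI0 measure0 mule0.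
  by case: ifP => // _; rewrite setI0 measure0 mule0.
have tG : trivIset setT G by move=> i j _ _ [w [<- <-]].
have GT : \bigcup_m G m = setT.
  by apply/seteqP; split => // w _; exists (pickle (kappa w)).
rewrite -(setIT E) -GT setI_bigcupr measure_semi_bigcup; last 3 first.
- by move=> m; exact: measurableI.
- exact: trivIset_setIl.
- by apply: bigcup_measurable => m _; exact: measurableI.
rewrite -[leRHS]mule1 -(probability_setT P) -GT measure_semi_bigcup //;
  last exact: bigcup_measurable.
rewrite -nneseriesZl //.
by apply: lee_nneseries => [m _ _|m _]; [exact: measure_ge0 | exact: leG].
Qed.

Lemma normal_prob_itv_le (R : realType) (a b : R) : a <= b ->
  (normal_prob 0 1 `[a, b]%classic <= (normal_peak 1 * (b - a))%:E)%E.
Proof.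
move=> ab; rewrite /normal_prob.
apply: (@le_trans _ _
  (\int[lebesgue_measure]_(x in `[a, b]) (normal_peak 1)%:E)%E).
  apply: ge0_le_integral => //.
  - by move=> x _; rewrite lee_fin normal_pdf_ge0.
  - apply/measurable_EFinP/measurable_funTS; exact: measurable_normal_pdf.
  - by move=> x _; rewrite lee_fin normal_pdf_ub // oner_neq0.
rewrite integral_cst //= lebesgue_measure_itv /= lte_fin EFinM.
by case: ltgtP ab => // -> _; rewrite subrr mule0.
Qed.

Lemma floor_divE (R : realType) (delta x : R) (k : int) : 0 < delta ->
  (Num.floor (x / delta) == k) =
  (x \in `[k%:~R * delta, (k + 1)%:~R * delta[).
Proof.
by move=> d0; rewrite floor_eq in_itv /= ler_pdivlMr // ltr_pdivrMr.
Qed.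

Lemma same_floor_dist (R : realType) (delta x y : R) : 0 < delta ->
  Num.floor (x / delta) = Num.floor (y / delta) -> `|x - y| <= delta.
Proof.
move=> d0 /eqP; rewrite floor_divE // in_itv /= => /andP[lx ux].
have := eqxx (Num.floor (y / delta)); rewrite {1}floor_divE // in_itv /=.
move=> /andP[ly uy].
rewrite ler_norml lerBlDl lerBrDl; apply/andP; split.
  have := uy; rewrite intrD mulrDl mul1r => /ltW h.
  by rewrite lerBlDr; apply: (le_trans h); rewrite lerD2r.
have := ux; rewrite intrD mulrDl mul1r => /ltW h.
by apply: (le_trans h); rewrite lerD2r.
Qed.

(** Once the other variables are fixed, [X i0] is determined, and its law has no
    atoms. The Lipschitz bound is the quantitative form of this that survives
    fixing the other variables only approximately. *)
Lemma independent_level_set_null (d : measure_display) (T : measurableType d)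
    (R : realType) (P : probability T R) (I : finType)
    (X : I -> {RV P >-> R}) (c : I -> R) (i0 : I) (K t : R) :
  mutually_independent X -> c i0 != 0 ->
  (forall a b : R, a <= b ->
    (P (X i0 @^-1` `[a, b]%classic) <= (K * (b - a))%:E)%E) ->
  P [set w | \sum_i c i * X i w = t] = 0%E.
Proof.
move=> indepX c0 lipX; set E := [set w | _].
have mE : measurable E.
  have mS : measurable_fun setT (fun w => \sum_i c i * X i w).
    apply: measurable_sum => i; exact: measurable_funM.
  rewrite (_ : E = (fun w => \sum_i c i * X i w) @^-1` [set t]) //.
  rewrite -[_ @^-1` _]setTI; exact: mS.
have K0 : 0 <= K.
  have := lipX 0 1 ler01; rewrite subr0 mulr1 => h.
  by rewrite -lee_fin; exact: le_trans h.
(* If the other variables move by at most delta, then X i0 moves along the level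
   set by at most M * delta. *)
pose M := (\sum_(i | i != i0) `|c i|) / `|c i0|.
have M0 : 0 <= M by rewrite divr_ge0 // sumr_ge0.
have KM0 : 0 <= K * (2 * M) by rewrite mulr_ge0 // mulr_ge0.
suff bound delta : 0 < delta -> (P E <= (K * (2 * M) * delta)%:E)%E.
  apply/eqP; rewrite eq_le measure_ge0 andbT.
  apply/lee_addgt0Pr => e e0; rewrite add0e.
  have N0 : 0 < K * (2 * M) + 1 by rewrite ltr_wpDl.
  apply: (le_trans (bound (e / (K * (2 * M) + 1)) _)).
    by rewrite divr_gt0.
  rewrite lee_fin mulrCA ler_piMr ?(ltW e0) // ler_pdivrMr // mul1r.
  by rewrite lerDl.
move=> d0.
(* The box of the other variables; the coordinate i0 is frozen at 0. *)
pose kappa w : {ffun I -> int} :=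
  [ffun i => if i == i0 then 0 else Num.floor (X i w / delta)].
pose cell (k : int) : set R := `[k%:~R * delta, (k + 1)%:~R * delta[%classic.
have kappaE (k : {ffun I -> int}) : k i0 = 0 ->
    kappa @^-1` [set k] =
      \bigcap_(i in [set` [set~ i0]%SET]) X i @^-1` cell (k i).
  move=> k0; apply/seteqP; split => [w <- i /= |w].
    rewrite !inE => ni0; rewrite /cell /= -floor_divE //.
    by rewrite ffunE (negPf ni0).
  move=> h; apply/ffunP => i; rewrite ffunE; case: eqVneq => [->//|ni0].
  apply/eqP; rewrite floor_divE //; apply: h; by rewrite /= !inE.
have kappa0 (k : {ffun I -> int}) : k i0 != 0 -> kappa @^-1` [set k] = set0.
  move=> k0; apply/seteqP; split => // w kw; move: k0.
  by rewrite -kw ffunE eqxx.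
have mpre i (B : set R) : measurable B -> measurable (X i @^-1` B).
  by move=> mB; rewrite -[_ @^-1` _]setTI; exact: measurable_funP.
have mcell m : measurable (cell m) by exact: measurable_itv.
apply: (@le_measure_fibres _ _ _ P _ kappa) => //.
- move=> k; have [k0|k0] := eqVneq (k i0) 0; last by rewrite kappa0.
  rewrite kappaE //; apply: fin_bigcap_measurable => // i _; exact: mpre.
- by rewrite mulr_ge0 // ltW.
move=> k.
have [->|/set0P[w0 [Ew0 kw0]]] := eqVneq (E `&` kappa @^-1` [set k]) set0.
  by rewrite measure0 mule_ge0 // lee_fin mulr_ge0 // ltW.
have k0 : k i0 = 0 by rewrite -kw0 ffunE eqxx.
(* w0 serves as a reference point: on the level set, X i0 stays near its value
   at w0 throughout the box. *)
pose J : set R := `[X i0 w0 - M * delta, X i0 w0 + M * delta]%classic.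
pose B i := if i == i0 then J else cell (k i).
have mB i : measurable (B i).
  by rewrite /B; case: ifP => _; [exact: measurable_itv | exact: mcell].
have sub : E `&` kappa @^-1` [set k] `<=`
    \bigcap_(i in [set` [set: I]%SET]) X i @^-1` B i.
  move=> w [Ew kw] i _; rewrite /B /=; case: eqVneq => [->|ni0]; last first.
    move: kw; rewrite kappaE // => /(_ i); apply; by rewrite /= !inE.
  rewrite /J /= in_itv /= -ler_distl.
  have : c i0 * (X i0 w - X i0 w0) =
      - \sum_(i | i != i0) c i * (X i w - X i w0).
    apply/eqP; rewrite -addr_eq0 -(bigD1 i0 (P := xpredT)
      (F := fun i => c i * (X i w - X i w0))) //=.
    under eq_bigr do rewrite mulrBr.
    by rewrite sumrB [X in X - _]Ew [X in _ - X]Ew0 subrr.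
  move=> /(congr1 Num.norm); rewrite normrM normrN => h.
  rewrite /M mulrAC ler_pdivlMr ?normr_gt0 // mulrC h mulr_suml.
  apply: (le_trans (ler_norm_sum _ _ _)); apply: ler_sum => j nj.
  rewrite normrM ler_wpM2l //; apply: same_floor_dist => //.
  have := kw0; rewrite -kw => /ffunP/(_ j); by rewrite !ffunE (negPf nj).
apply: (@le_trans _ _ (P (\bigcap_(i in [set` [set: I]%SET]) X i @^-1` B i))).
  apply: le_measure => //; rewrite inE.
    apply: measurableI => //; rewrite kappaE //.
    by apply: fin_bigcap_measurable => // i _; exact: mpre.
  by apply: fin_bigcap_measurable => // i _; exact: mpre.
rewrite kappaE // (indepX _ B) // (indepX _ (fun i => cell (k i))) //.
rewrite (bigD1 i0) ?inE //=.
have -> : (\prod_(i in [set: I]%SET | i != i0) P (X i @^-1` B i) =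
    \prod_(i in [set~ i0]%SET) P (X i @^-1` cell (k i)))%E.
  apply: eq_big => [i|i /andP[_ /negPf ni0]]; first by rewrite !inE.
  by rewrite /B ni0.
apply: lee_wpmul2r; first by apply: prode_ge0 => i _; exact: measure_ge0.
rewrite /B eqxx; apply: le_trans (lipX _ _ _) _.
  by rewrite lerD2l ge0_cp // mulr_ge0 // ltW.
rewrite lee_fin -mulrA ler_wpM2l //.
by rewrite opprB addrC addrA subrK -mulr2n mulr_natl mulrnAl.
Qed.

(** * Exactness with probability one *)

Theorem proposition1p5 (d : measure_display) (T : measurableType d)
    (R : realType) (P : probability T R) (n l q : nat) (A : 'M[R]_n)
    (Omega : 'M[{RV P >-> R}]_(n, l)) :
  (0 < n)%N -> (1 <= l)%N -> A^T = A ->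
  standard_normal_mx Omega ->
  (eigenvalues A #<= `I_q.+1)%card ->
  {ae P, forall w, err A (xi_max A (realization Omega w) q) = 0%E}.
Proof.
case: n A Omega => // n A Omega _; case: l Omega => // l Omega _.
move=> symA [normalOmega indepOmega] cardA.
have [a eiga lea] := symmetric_max_eigenvalue symA.
have /eigenvalueP[u eqA /rV0Pn[i0 ui0]] := eiga.
pose X (ij : 'I_n.+1 * 'I_l.+1) := Omega ij.1 ij.2.
(* The relation u x = 0, for x the first column, as a combination of all the
   entries, which is the family known to be independent. *)
pose c (ij : 'I_n.+1 * 'I_l.+1) := if ij.2 == ord0 then u 0 ij.1 else 0.
have sumE w : \sum_ij c ij * X ij w = (u *m realization Omega w) 0 0.
  rewrite -(pair_bigA _ (fun i j => c (i, j) * X (i, j) w)) mxE /=.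
  apply: eq_bigr => i _; rewrite (bigD1 ord0) //= big1 ?addr0 => [|j /negPf j0].
    by rewrite mxE /c eqxx.
  by rewrite /c /= j0 mul0r.
have null : P [set w | \sum_ij c ij * X ij w = 0] = 0%E.
  apply: (independent_level_set_null (i0 := (i0, ord0))
    (K := normal_peak 1)) => //.
  move=> x y xy; apply: le_trans (normal_prob_itv_le xy).
  by rewrite -(normalOmega i0 ord0 `[x, y]%classic).
exists [set w | \sum_ij c ij * X ij w = 0]; split => //.
  have mS : measurable_fun setT (fun w => \sum_ij c ij * X ij w).
    by apply: measurable_sum => ij; exact: measurable_funM.
  by rewrite -[[set _ | _]]setTI; exact: (mS measurableT [set 0]).
move=> w /=; apply: contra_notP => ne; rewrite /err.
rewrite (xi_max_exact symA cardA lea eqA); last first.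
  by apply/rV0Pn; exists 0; rewrite -sumE; exact/eqP.
(* The numerator 0 settles the case of a single eigenvalue too, where the
   inverse of the denominator is +oo. *)
by rewrite (@max_ofE _ (eigenvalues A) a) // subrr mul0e.
Qed.
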